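(* Consider the network model, interest-based mobility model and FirstMeeting (FM) routing described in the context, with $\delta=\delta(n)>0$, $\delta(n)\to 0$. Let $T^{ib}_{FM}$ be the time at which the message is first delivered to $D$. Then there exist constants $c,c'>0$ (independent of $n$) such that for all sufficiently large $n$, $$\mathbb{E}[T^{ib}_{FM}] \ge \min\Big\{c\log(1/\delta(n)),\ \frac{c' n}{\log n}\Big\}.$$ In particular $\mathbb{E}[T^{ib}_{FM}]\to\infty$ as $n\to\infty$.
   Context: Network: fix an integer $m\ge 2$ independent of $n$. There are $n+2$ nodes: a source $S$, a destination $D$ and relays $R_1,\dots,R_n$. Each node $X$ has an interest profile, a unit vector in the closed positive orthant of the unit sphere of $\mathbb{R}^m$; $\angle(X,Y)$ denotes the angle between two profiles, so $\cos\angle(X,Y)=\langle X,Y\rangle\in[0,1]$. $S=(1,0,\dots,0)$ and $D=(0,1,0,\dots,0)$. The relay profiles are i.i.d.: the angle $\alpha_i=\angle(S,R_i)$ is uniform on $[0,\pi/2]$, and given $\alpha_i$, $R_i$ is uniform among unit vectors of the positive orthant making angle $\alpha_i$ with $S$. Profiles do not change in time. Conditional on the profiles, for each unordered pair $\{A,B\}$ of nodes the meeting instants of $A$ and $B$ form a Poisson process of rate $\lambda_{AB}$ (so the first meeting time is exponential with rate $\lambda_{AB}$), independently over pairs, starting at time $0$. Interest-based mobility: $\lambda_{AB}=k\cos\angle(A,B)+\delta$, where $\lambda>0$ is a fixed constant, $\delta=\delta(n)>0$ with $\delta(n)\to 0$, and $k=\frac{\pi}{2}(\lambda-\delta)$ (so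 that $\mathbb{E}[\lambda_{SR_i}]=\lambda$). FM routing: $S$ holds two copies of a message for $D$ and always keeps one. If the first node met by $S$ among $\{D,R_1,\dots,R_n\}$ is $D$, the message is delivered at that time. Otherwise, if it is $R_j$, the second copy is given to $R_j$; no further copies are created or transferred, and the message is delivered when the first of $S,R_j$ meets $D$. Expectations are over both the random profiles and the meeting processes. *)

(* Defs.v *)
From HB Require Import structures.
From mathcomp Require Import all_boot all_order all_algebra.
From mathcomp Require Import all_classical all_reals all_analysis.
Set Implicit Arguments. Unset Strict Implicit. Unset Printing Implicit Defensive.
Import Order.TTheory GRing.Theory Num.Def Num.Theory.
Import numFieldNormedType.Exports.
Local Open Scope classical_set_scope.
Local Open Scope ring_scope.

(*  - A vector of R^k is represented by v : nat -> R, only the coordinates  *)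
(*    0..k-1 being relevant.                                                *)
(*  - Nodes are labelled by naturals: 0 = S, 1 = D, i.+2 = relay R_i        *)
(*    (i < n).                                                              *)

Section Defs.
Context {R : realType}.

Definition dotp (k : nat) (x y : nat -> R) : R := \sum_(j < k) x j * y j.
Definition vnorm (k : nat) (x : nat -> R) : R := Num.sqrt (dotp k x x).

Definition upd (v : nat -> R) (i : nat) (t : R) : nat -> R :=
  fun j => if j == i then t else v j.

Fixpoint cube_int (k : nat) (f : (nat -> R) -> \bar R) : \bar R :=
  match k with
  | 0 => f (fun _ => 0)
  | k'.+1 => (\int[lebesgue_measure]_(t in `[0%R, 1%R]) cube_int k' (fun v => f (upd v k' t)))%E
  end.

Definition leb_cube (k : nat) (C : set (nat -> R)) : \bar R :=
  cube_int k (fun v => (\1_C v)%:E).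

(* Uniform (normalized surface) measure on the positive orthant of the unit
   sphere of R^k, given by the cone measure:
     sigma(A) = Leb_k {t x | 0 < t <= 1, x in A} / Leb_k (B^k ∩ R_+^k),
   evaluated on the "rectangle" A = {x in S^{k-1}_+ | forall j<k, x_j in B_j}.
   The cone over such an A is {v in [0,1]^k | 0 < |v| <= 1 /\ forall j<k,
   v_j/|v| in B_j}. *)
Definition orth_cone (k : nat) (B : nat -> set R) : set (nat -> R) :=
  [set v | 0 < vnorm k v <= 1 /\ forall j, (j < k)%N -> B j (v j / vnorm k v)].
Definition orth_ball (k : nat) : set (nat -> R) := [set v | vnorm k v <= 1].

Definition profS : nat -> R := fun j => if j == 0%N then 1 else 0.
Definition profD : nat -> R := fun j => if j == 1%N then 1 else 0.
(* relay profile with angle a to S and "direction" w in S^{m-2}_+ :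
   (cos a, sin a * w_0, ..., sin a * w_{m-2}) *)
Definition profR (a : R) (w : nat -> R) : nat -> R :=
  fun j => if j == 0%N then cos a else sin a * w j.-1.

Definition prof (al : nat -> R) (w : nat -> nat -> R) (x : nat) : nat -> R :=
  match x with
  | 0 => profS
  | 1 => profD
  | i.+2 => profR (al i) (w i)
  end.

(* interest-based meeting rate lambda_AB = k cos angle(A,B) + delta,
   k = pi/2 (lambda - delta) *)
Definition ib_rate (m : nat) (lam dl : R) (X Y : nat -> R) : R :=
  (pi / 2 * (lam - dl)) * dotp m X Y + dl.

(* l-th meeting instant (l = 0 is the first) of a Poisson process of rate r
   built from the standard exponential inter-arrival variables e 0, e 1, ... *)
Definition arrival (r : R) (e : nat -> R) (l : nat) : R :=
  (\sum_(i < l.+1) e i) / r.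

Section Sample.
Variables (m n : nat) (lam dl : R).
Variables (al : nat -> R) (w : nat -> nat -> R) (e : nat -> nat -> nat -> R).

Definition meet (x y l : nat) : R :=
  arrival (ib_rate m lam dl (prof al w x) (prof al w y)) (e x y) l.

Definition tSD : R := meet 0 1 0.
Definition tSR (i : 'I_n) : R := meet 0 i.+2 0.
Definition tau : R := \big[Order.min/tSD]_(i < n) tSR i.

Definition T_FM : R :=
  if [forall i : 'I_n, tSD <= tSR i] then tSD
  else match [pick j : 'I_n | tSR j == tau] with
       | Some j => Order.min tSD
                     (inf [set meet 1 j.+2 l | l in [set l | tau <= meet 1 j.+2 l]])
       | None => tSD
       end.
End Sample.

(* Independence.  The primitive random "blocks" are indexed by
     inl (inl i)        : the angle alpha_i           (a scalar),
     inl (inr i)        : the direction u_i of R_i    (a vector of R^{m-1}),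
     inr (x, y, l)      : the l-th standard exponential inter-arrival variable
                          of the pair {x, y} (x < y)  (a scalar).        *)
Definition blk := ((nat + nat) + (nat * nat * nat))%type.

Definition blk_valid (n : nat) (b : blk) : bool :=
  match b with
  | inl (inl i) => (i < n)%N
  | inl (inr i) => (i < n)%N
  | inr (x, y, _) => (x < y)%N && (y < n.+2)%N
  end.

Definition blk_dim (m : nat) (b : blk) : nat :=
  match b with inl (inr _) => m.-1 | _ => 1%N end.

Definition blk_rv {Omega : Type} (alpha : nat -> Omega -> R)
  (u : nat -> Omega -> nat -> R) (E : nat -> nat -> nat -> Omega -> R)
  (b : blk) : Omega -> nat -> R :=
  match b with
  | inl (inl i) => fun om _ => alpha i om
  | inl (inr i) => u i
  | inr (x, y, l) => fun om _ => E x y l om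
  end.

(* mutual independence of a family of random vectors (X b) (b valid), each
   with dim b relevant coordinates: product rule on measurable rectangles
   (a pi-system generating each sigma(X b)) for every finite subfamily *)
Definition mutually_independent {d : measure_display} {Omega : measurableType d}
  (P : probability Omega R) (valid : blk -> bool) (dim : blk -> nat)
  (X : blk -> Omega -> nat -> R) : Prop :=
  forall (s : seq blk) (B : blk -> nat -> set R),
    uniq s -> all valid s -> (forall b j, measurable (B b j)) ->
    P (\big[setI/setT]_(b <- s) [set om | forall j, (j < dim b)%N -> B b j (X b om j)])
    = (\prod_(b <- s) P [set om | forall j, (j < dim b)%N -> B b j (X b om j)])%E.

(* The full model for n relays: angles alpha_i uniform on [0, pi/2],
   directions u_i uniform on the positive orthant of S^{m-2}, so that
   R_i = (cos alpha_i, sin alpha_i u_i) is uniform on the slice of profiles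
   at angle alpha_i from S; meeting processes Poisson with rate lambda_AB
   given the profiles (standard exponential inter-arrivals divided by
   lambda_AB), everything independent. *)
Definition FM_model {d : measure_display} {Omega : measurableType d}
  (P : probability Omega R) (m n : nat)
  (alpha : nat -> Omega -> R) (u : nat -> Omega -> nat -> R)
  (E : nat -> nat -> nat -> Omega -> R) : Prop :=
  [/\ (forall i, measurable_fun setT (alpha i)),
      (forall i j, measurable_fun setT (fun om => u i om j)),
      (forall x y l, measurable_fun setT (E x y l)) &
      mutually_independent P (blk_valid n) (blk_dim m) (blk_rv alpha u E)] /\
  [/\
      (forall i, (i < n)%N -> forall B : set R, measurable B ->
         P (alpha i @^-1` B)
         = (\int[lebesgue_measure]_(x in B) (uniform_pdf 0 (pi / 2) x)%:E)%E),
      (forall i, (i < n)%N -> forall B : nat -> set R, (forall j, measurable (B j)) ->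
         (P [set om | forall j, (j < m.-1)%N -> B j (u i om j)]
            * leb_cube m.-1 (orth_ball m.-1))%E
         = leb_cube m.-1 (orth_cone m.-1 B)) &
      (forall x y l, (x < y)%N -> (y < n.+2)%N -> forall B : set R, measurable B ->
         P (E x y l @^-1` B) = exponential_prob 1 B)].

Definition T_FM_rv {Omega : Type} (m n : nat) (lam dl : R)
  (alpha : nat -> Omega -> R) (u : nat -> Omega -> nat -> R)
  (E : nat -> nat -> nat -> Omega -> R) (om : Omega) : R :=
  T_FM m n lam dl (fun i => alpha i om) (fun i => u i om) (fun x y l => E x y l om).

End Defs.

(* Main.v *)
Require Import Defs.
From HB Require Import structures.
From mathcomp Require Import all_boot all_order all_algebra.
From mathcomp Require Import all_classical all_reals all_analysis.
From mathcomp Require Import measurable_realfun ring lra.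
Import Order.TTheory GRing.Theory Num.Def Num.Theory.
Import numFieldNormedType.Exports.
Local Open Scope classical_set_scope.
Local Open Scope ring_scope.

(* In fact E[T_FM] >= c log(1/delta(n)).  If the chosen relay R_j has angle
   alpha_j <= x to S, its meeting rate with D is O(x + delta), so that the
   residual delivery time is of order 1/x as long as x >= delta.  The angle
   alpha_j lies in the dyadic interval ]2^-(r+1), 2^-r] with probability of
   order 2^-r, and given this R_j is the first relay met with probability at
   least of order 1/n, since all the rates lambda_SRi are at most pi/2 lambda
   and that of R_j is at least a constant fraction of it.  Each of the n relays
   and each of the scales 2^-r >= delta thus contributes order 2^r 2^-r / n,
   and there are about log(1/delta) scales. *)

(** * Comparison of integrals without measurability *)

Section Integral.
Context {d : measure_display} {T : measurableType d} {R : realType}.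
Variable mu : {measure set T -> \bar R}.
Import HBNNSimple.
Local Open Scope ereal_scope.

(* The integral of a nonnegative function is a supremum over the simple functions
   below it, hence monotone without measurability; the measurability of T_FM is
   never established. *)
Lemma ge0_le_integral_nonmeasurable (D : set T) (f g : T -> \bar R) :
  (forall x, D x -> 0 <= f x) -> (forall x, D x -> f x <= g x) ->
  \int[mu]_(x in D) f x <= \int[mu]_(x in D) g x.
Proof.
move=> f0 fg; rewrite !ge0_integralE//; last first.
  by move=> x Dx; exact: le_trans (f0 x Dx) (fg x Dx).
apply: ereal_sup_le => _ [h /= hf <-]; exists h => //= x; apply: le_trans (hf x) _.
exact: lee_restrict.
Qed.

(** Meant for [T_FM], which is nonnegative only almost surely. The negative part of [f] vanishes off
    the null set [N] and is at most [+oo] on it, so it integrates to 0. *)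
Lemma ae_ge0_le_integral_nonmeasurable (N : set T) (f g : T -> \bar R) :
  measurable N -> mu N = 0 -> (forall x, ~ N x -> 0 <= f x) ->
  (forall x, 0 <= g x) -> (forall x, g x <= f^\+ x) ->
  \int[mu]_x g x <= \int[mu]_x f x.
Proof.
move=> mN N0 f0 g0 gf; rewrite [leRHS]integralE.
suff -> : \int[mu]_x f^\- x = 0.
  by rewrite sube0; exact: ge0_le_integral_nonmeasurable.
apply/eqP; rewrite eq_le integral_ge0// andbT.
have <- : \int[mu]_(x in N) (cst +oo) x = 0.
  by rewrite integral_cst// N0 mule0.
rewrite [leRHS]integral_mkcond/=.
apply: ge0_le_integral_nonmeasurable => // x _.
rewrite patchE; case: ifPn => [|/negP]; first by rewrite leey.
rewrite inE => /f0 fx0; rewrite funenegE /Order.max; case: ifPn => //.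
by rewrite -leNgt leeNl oppe0.
Qed.
End Integral.

(** * Exponential and uniform laws *)

Section Laws.
Context {d : measure_display} {Omega : measurableType d} {R : realType}.
Variables (P : probability Omega R) (X : Omega -> R).
Hypothesis mX : measurable_fun setT X.

Let mpre (B : set R) : measurable B -> measurable (X @^-1` B).
Proof. by move=> mB; rewrite -[_ @^-1` _]setTI; exact: mX. Qed.

Section Exponential.
Hypothesis PX : forall B, measurable B -> P (X @^-1` B) = exponential_prob 1 B.

Lemma exponential_neg0 : P (X @^-1` `]-oo, 0[) = 0%E.
Proof.
rewrite PX// /exponential_prob integral0_eq// => x /=.
by rewrite in_itv/= => x0; rewrite lt0_exponential_pdf.
Qed.

Lemma exponential_head (s : R) : 0 < s ->
  P (X @^-1` `[0, s]) = (1 - expR (- s))%:E.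
Proof. by move=> s0; rewrite PX// exponential_prob_itv0c// mulN1r EFinB. Qed.

Lemma exponential_tail (s : R) : 0 < s ->
  ((expR (- s))%:E <= P (X @^-1` `[s, +oo[))%E.
Proof.
move=> s0.
have -> : X @^-1` `[s, +oo[ = ~` (X @^-1` `]-oo, s[).
  apply/seteqP; split => x /=; rewrite !in_itv/= ?andbT => h.
    by apply/negP; rewrite -leNgt.
  by rewrite leNgt; exact/negP.
rewrite probability_setC; last exact: mpre.
have : (P (X @^-1` `]-oo, s[) <= (1 - expR (- s))%:E)%E.
  rewrite -exponential_head// -[leRHS]add0e -exponential_neg0.
  apply: (@le_trans _ _ (P (X @^-1` `]-oo, 0[ `|` X @^-1` `[0, s]))); last first.
    by apply: measureU2; exact: mpre.
  apply: le_measure; rewrite ?inE.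
  - exact: mpre.
  - by apply: measurableU; exact: mpre.
  - move=> x /=; rewrite !in_itv/= => xs.
    by have [x0|x0] := ltP (X x) 0; [left|right; rewrite ltW].
have /fineK <- : P (X @^-1` `]-oo, s[) \is a fin_num.
  by apply: fin_num_measure; exact: mpre.
by rewrite -EFinB !lee_fin; lra.
Qed.
End Exponential.

Section Uniform.
Variables a b : R.
Hypothesis (PX : forall B, measurable B ->
  P (X @^-1` B) = (\int[lebesgue_measure]_(x in B) (uniform_pdf a b x)%:E)%E).

Lemma uniform_itv (x y : R) : a <= x -> x < y -> y <= b ->
  P (X @^-1` `]x, y]) = ((y - x) / (b - a))%:E.
Proof.
move=> ax xy yb; rewrite PX//.
rewrite (eq_integral (fun=> (b - a)^-1%:E)); last first.
  move=> t; rewrite inE/= in_itv/= /uniform_pdf => /andP[xt ty].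
  by rewrite ifT// (ltW (le_lt_trans ax xt)) (le_trans ty yb).
rewrite integral_cst//= lebesgue_measure_itv/= lte_fin xy.
by rewrite -EFinD -EFinM mulrC.
Qed.

Lemma uniform_outside0 : P (X @^-1` (~` `[a, b])) = 0%E.
Proof.
rewrite PX; last exact: measurableC.
by rewrite integral_uniform_pdf setICl integral_set0.
Qed.
End Uniform.
End Laws.

(** * Volumes in the unit cube *)

Section Cube.
Context {R : realType}.
Implicit Types f : (nat -> R) -> \bar R.

Lemma cube_int_ge0 k f : (forall v, 0 <= f v)%E -> (0 <= cube_int k f)%E.
Proof.
elim: k f => [|k IH] f f0 //=.
by apply: integral_ge0 => t _; apply: IH.
Qed.

Lemma cube_int_le1 k f : (forall v, 0 <= f v)%E -> (forall v, f v <= 1)%E ->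
  (cube_int k f <= 1)%E.
Proof.
elim: k f => [|k IH] f f0 f1 //=.
apply: (@le_trans _ _ (\int[lebesgue_measure]_(t in `[0%R, 1%R]) (cst 1 t))%E).
  apply: ge0_le_integral_nonmeasurable => t _; first exact: cube_int_ge0.
  exact: IH.
rewrite integral_cst//= lebesgue_measure_itv/= lte_fin ltr01 oppr0 adde0.
by rewrite mule1.
Qed.

(** Induction on the dimension, shrinking each integral from [0, 1] to [a, b]. Only monotonicity is
    used, so [f] may be non-measurable. *)
Lemma cube_int_box k f (a b : R) : 0 <= a -> a < b -> b <= 1 ->
  (forall v, 0 <= f v)%E ->
  (forall v, (forall j, (j < k)%N -> a <= v j <= b) -> (1 <= f v)%E) ->
  (((b - a) ^+ k)%:E <= cube_int k f)%E.
Proof.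
move=> a0 ab b1; elim: k f => [|k IH] f f0 f1 /=; first by rewrite expr0 f1.
apply: (@le_trans _ _
    (\int[lebesgue_measure]_(t in `[a, b]) (cst ((b - a) ^+ k)%:E t))%E).
  rewrite integral_cst//= lebesgue_measure_itv/= lte_fin ab -EFinB -EFinM.
  by rewrite exprSr.
rewrite [leLHS]integral_mkcond [leRHS]integral_mkcond.
apply: ge0_le_integral_nonmeasurable => t _; rewrite !patchE.
  by case: ifPn => // _; rewrite lee_fin exprn_ge0// subr_ge0 ltW.
case: ifPn => [|_]; last first.
  by case: ifPn => // _; exact: cube_int_ge0.
rewrite !inE/= !in_itv/= => /andP[at_ tb]; rewrite ifT; last first.
  by rewrite inE/= in_itv/= (le_trans a0 at_) (le_trans tb b1).
apply: IH => // v hv; apply: f1 => j; rewrite ltnS leq_eqVlt /upd.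
by case: eqP => [_ _|_ /= jk]; [rewrite at_ tb|exact: hv].
Qed.

Lemma box_direction_in_unit_box (k : nat) (v : nat -> R) : (0 < k)%N ->
  (forall j, (j < k)%N -> (2 * k)%:R^-1 <= v j <= k%:R^-1) ->
  [/\ 0 < vnorm k v <= 1 &
      forall j, (j < k)%N -> 0 <= v j / vnorm k v <= 1].
Proof.
move=> k0 hv.
have v0 j : (j < k)%N -> 0 < v j.
  by move=> /hv/andP[+ _]; apply: lt_le_trans; rewrite invr_gt0 ltr0n muln_gt0.
have vle j : (j < k)%N -> v j <= vnorm k v.
  move=> jk; rewrite /vnorm -(ger0_norm (ltW (v0 j jk))) -sqrtr_sqr.
  apply: ler_wsqrtr; rewrite /dotp (bigD1 (Ordinal jk))//= expr2 lerDl.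
  by apply: sumr_ge0 => i _; rewrite -expr2 sqr_ge0.
have n0 : 0 < vnorm k v by apply: lt_le_trans (vle _ k0); exact: v0.
split.
  rewrite n0/= /vnorm -sqrtr1; apply: ler_wsqrtr.
  (* Each v_j is at most 1/k <= 1, so v_j^2 <= 1/k and the k squares add up to at most 1. *)
  apply: (@le_trans _ _ (\sum_(j < k) k%:R^-1)).
    apply: ler_sum => i _; have /andP[_ h] := hv i (ltn_ord i).
    rewrite -[leRHS]mulr1; apply: ler_pM => //; rewrite ?(ltW (v0 _ _))//.
    by rewrite (le_trans h)// invf_le1 ?ler1n ?ltr0n.
  by rewrite sumr_const card_ord -[leLHS]mulr_natl mulfV// pnatr_eq0 -lt0n.
by move=> j jk; rewrite ler_pdivrMr// mul1r vle// divr_ge0// ltW// v0.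
Qed.

(** The cone contains the box [1/2k, 1/k]^k, of side 1/k - 1/2k = 1/2k. The bound is crude, but any
    positive constant depending on k alone is enough. *)
Lemma orth_cone_unit_box (k : nat) : (0 < k)%N ->
  ((((2 * k)%:R^-1) ^+ k)%:E <= leb_cube k (orth_cone k (fun=> `[0%R, 1%R]%classic))
    :> \bar R)%E.
Proof.
move=> k0.
have k0' : (0 : R) < k%:R by rewrite ltr0n.
have e : (2 * k)%:R^-1 = k%:R^-1 - (2 * k)%:R^-1 :> R.
  by rewrite natrM; field; rewrite gt_eqF.
rewrite [X in X ^+ _]e; apply: cube_int_box => //.
- by rewrite natrM ltf_pV2 ?posrE ?mulr_gt0//; lra.
- by rewrite invf_le1// ler1n.
- move=> v hv; rewrite lee_fin indicE mem_set//.
  by have [h1 h2] := box_direction_in_unit_box k v k0 hv; split.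
Qed.

End Cube.

(** * Elementary bounds on sine and cosine *)

Lemma sin_le_id (R : realType) (x : R) : 0 <= x -> sin x <= x.
Proof.
move=> x0.
have dsin y : y \in `]0, x[ -> is_derive y 1 sin (cos y).
  by move=> _; exact: is_derive_sin.
have csin : {within `[0, x], continuous (@sin R)}.
  by apply: continuous_subspaceT => y; exact: continuous_sin.
have [c _] := MVT_segment x0 dsin csin.
by rewrite sin0 !subr0 => ->; rewrite -[leRHS]mul1r ler_wpM2r// cos_le1.
Qed.

(** As 0 <= cos x <= 1, cos x >= cos^2 x = 1 - sin^2 x, and sin x <= x. *)
Lemma cos_ge_onesubsqr (R : realType) (x : R) : 0 <= x <= pi / 2 ->
  1 - x ^+ 2 <= cos x.
Proof.
move=> /andP[x0 xpi].
have c0 : 0 <= cos x.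
  by apply: cos_ge0_pihalf; rewrite xpi (le_trans _ x0)// oppr_le0 (le_trans x0).
have s0 : 0 <= sin x.
  by apply: sin_ge0_pi; rewrite x0 (le_trans xpi)// ; have := pi_ge0 R; lra.
have := cos2Dsin2 x; have := sin_le_id _ _ x0; have := cos_le1 x; nra.
Qed.

(** * Meeting rates in terms of angles and directions *)

Section Rate.
Context {R : realType}.
Variables (m : nat) (lam dl : R) (al : nat -> R) (w : nat -> nat -> R).
Hypothesis m2 : (2 <= m)%N.

Let rate x y := ib_rate m lam dl (prof al w x) (prof al w y).

Lemma rate_SD : rate 0 1 = dl.
Proof.
rewrite /rate /ib_rate /dotp big1 ?mulr0 ?add0r// => i _.
by rewrite /= /profS /profD; case: eqP => [->|_]; rewrite ?mulr0 ?mul0r.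
Qed.

Lemma rate_SR i : rate 0 i.+2 = pi / 2 * (lam - dl) * cos (al i) + dl.
Proof.
rewrite /rate /ib_rate /dotp.
rewrite (bigD1 (Ordinal (ltnW m2)))//= big1 ?addr0; last first.
  by move=> j /negbTE; rewrite -val_eqE/= /profS => ->; rewrite mul0r.
by rewrite /profS /profR /= mul1r.
Qed.

Lemma rate_DR i : rate 1 i.+2 = pi / 2 * (lam - dl) * (sin (al i) * w i 0) + dl.
Proof.
rewrite /rate /ib_rate /dotp.
rewrite (bigD1 (Ordinal m2))//= big1 ?addr0; last first.
  by move=> j /negbTE; rewrite -val_eqE/= /profD => ->; rewrite mul0r.
by rewrite /profD /profR /= mul1r.
Qed.
End Rate.

(** * Bounds on the delivery time for a fixed outcome *)

Section Path.
Context {R : realType}.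
Variables (m n : nat) (lam dl : R).
Variables (al : nat -> R) (w : nat -> nat -> R) (e : nat -> nat -> nat -> R).
Hypotheses (m2 : (2 <= m)%N) (lam0 : 0 < lam) (dl0 : 0 < dl) (dlle : dl <= lam / 2).
Hypothesis al_itv : forall i, (i < n)%N -> 0 <= al i <= pi / 2.

Let tSDE : tSD m lam dl al w e = e 0 1 0 / dl.
Proof. by rewrite /tSD /meet /arrival big_ord1 rate_SD. Qed.

Let tSRE (i : 'I_n) : tSR m lam dl al w e i =
  e 0 i.+2 0 / (pi / 2 * (lam - dl) * cos (al i) + dl).
Proof. by rewrite /tSR /meet /arrival big_ord1 rate_SR. Qed.

Let cos_al_ge0 i : (i < n)%N -> 0 <= cos (al i).
Proof.
move=> /al_itv/andP[a0 api]; apply: cos_ge0_pihalf; rewrite api andbT.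
by rewrite (le_trans _ a0)// oppr_le0 (le_trans a0).
Qed.

Let pi_gt2 : (2 : R) <= pi. Proof. exact: pi_ge2. Qed.

Let gain0 : 0 < pi / 2 * (lam - dl).
Proof. by rewrite mulr_gt0//; move: pi_gt2 lam0 dlle; lra. Qed.

Let rate_le c : 0 <= c <= 1 -> pi / 2 * (lam - dl) * c + dl <= pi / 2 * lam.
Proof.
move=> /andP[c0 c1]; apply: (@le_trans _ _ (pi / 2 * (lam - dl) + dl)).
  by rewrite lerD2r ler_piMr// ltW.
(* The slack is (pi/2 - 1) dl, nonnegative because pi >= 2. *)
by move: dl0 pi_gt2; nra.
Qed.

Let rate_gt0 c : 0 <= c -> 0 < pi / 2 * (lam - dl) * c + dl.
Proof. by move=> c0; rewrite ltr_wpDl// mulr_ge0// ltW. Qed.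

Lemma T_FM_ge0 : (forall y, (0 < y < n.+2)%N -> 0 <= e 0 y 0) ->
  0 <= T_FM m n lam dl al w e.
Proof.
move=> e0; have tD0 : 0 <= tSD m lam dl al w e.
  by rewrite tSDE; apply: divr_ge0 (ltW dl0); exact: e0.
rewrite /T_FM; case: ifP => // _; case: pickP => // j _.
rewrite le_min tD0/=.
set A := [set _ | _ in _].
(* Nothing here ensures that R_j meets D after [tau], but the infimum of the empty set is 0, which
   is harmless for this bound. *)
have [->|/set0P An0] := eqVneq A set0; first by rewrite inf0.
apply: lb_le_inf => // _ [l /= h <-]; apply: le_trans h.
apply: le_bigmin => // i _; rewrite tSRE; apply: divr_ge0.
  by apply: e0; rewrite /= !ltnS.
exact/ltW/rate_gt0/cos_al_ge0.
Qed.

(* The hypotheses force R_j to be the first node met by S, before time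
   1 / (n K) with K = pi/2 lam an upper bound on all the rates; the first
   D-R_j meeting comes after 1 / (x (K + 1)) and after 1 / K, hence later than
   the hand-over. *)
Lemma T_FM_ge (j : 'I_n) (x : R) :
  0 < x <= 2^-1 -> dl <= x -> al j <= x -> 0 <= w j 0 <= 1 ->
  0 <= e 0 j.+2 0 <= (4 * n)%:R^-1 ->
  (forall i, (i < n)%N -> i != j -> n%:R^-1 <= e 0 i.+2 0) ->
  1 <= e 0 1 0 -> 1 <= e 1 j.+2 0 -> (forall l, 0 <= e 1 j.+2 l) ->
  (x * (pi / 2 * lam + 1))^-1 <= T_FM m n lam dl al w e.
Proof.
set K := pi / 2 * lam.
move=> /andP[x0 x2] dlx alx w01 /andP[ej0 ejn] ei eD ejD ejl.
have K0 : 0 < K by rewrite mulr_gt0// divr_gt0// (lt_le_trans _ pi_gt2).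
have n1 : (1 : R) <= n%:R by rewrite ler1n (leq_ltn_trans _ (ltn_ord j)).
have nK0 : 0 < n%:R * K by rewrite mulr_gt0// (lt_le_trans _ n1).
have lamK : lam <= K.
  by rewrite /K ler_peMl ?ler_pdivlMr ?mul1r// ltW.
have dlK : dl < K by move: lamK lam0 dlle; lra.
have dlnK : dl < n%:R * K.
  by rewrite (lt_le_trans dlK)// -[leLHS]mul1r ler_wpM2r// ltW.
have /andP[aj0 ajpi] := al_itv j (ltn_ord j).
have tj : tSR m lam dl al w e j < (n%:R * K)^-1.
  rewrite tSRE ltr_pdivrMr; last exact/rate_gt0/cos_al_ge0.
  apply: (le_lt_trans ejn).
  (* It remains to see that the S-R_j rate exceeds K/4. *)
  have -> : (4 * n)%:R^-1 = (n%:R * K)^-1 * (K / 4) :> R.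
    by rewrite natrM; field; rewrite !gt_eqF//= (lt_le_trans _ n1).
  rewrite ltr_pM2l ?invr_gt0//.
  have : 3 / 4 <= cos (al j).
    have ajh : al j <= 2^-1 := le_trans alx x2.
    apply: le_trans (cos_ge_onesubsqr _ _ (al_itv j (ltn_ord j))).
    have : al j ^+ 2 <= 2^-1 ^+ 2 by rewrite lerXn2r ?nnegrE.
    lra.
  (* Since dl <= lam/2, the gain pi/2 (lam - dl) is at least K/2, so the rate exceeds 3/4 * K/2 =
     3K/8. *)
  move=> c34; have gK : K <= 2 * (pi / 2 * (lam - dl)).
    by rewrite /K mulrCA ler_wpM2l//; move: pi_gt2 dlle; lra.
  have := ler_wpM2l (ltW gain0) c34.
  by move: gain0 gK dl0 K0; lra.
have tD : (n%:R * K)^-1 < tSD m lam dl al w e.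
  rewrite tSDE (@lt_le_trans _ _ dl^-1)//; first by rewrite ltf_pV2.
  by rewrite -[leLHS]mul1r ler_wpM2r// invr_ge0 ltW.
have ti (i : 'I_n) : i != j -> (n%:R * K)^-1 <= tSR m lam dl al w e i.
  move=> ij; rewrite tSRE invfM; apply: ler_pM.
  - by rewrite invr_ge0.
  - by rewrite invr_ge0 ltW.
  - exact: ei.
  - rewrite lef_pV2 ?posrE//; last exact/rate_gt0/cos_al_ge0.
    by apply: rate_le; rewrite cos_al_ge0//= cos_le1.
have tauE : tau m n lam dl al w e = tSR m lam dl al w e j.
  apply/le_anti; rewrite /tau bigmin_le/=.
  apply: le_bigmin => [|i _]; first exact/ltW/(lt_trans tj).
  have [->//|/ti] := eqVneq i j; apply: le_trans; exact: ltW.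
rewrite /T_FM ifF; last first.
  by apply/negbTE/forallPn; exists j; rewrite -ltNge (lt_trans tj).
case: pickP => [i|/(_ j)]; last by rewrite tauE eqxx.
rewrite tauE => /eqP tij.
(* All other relays are met strictly later than R_j, so [pick] can only return j. *)
have {i tij} -> : i = j.
  by apply/eqP/negPn/negP => /ti; rewrite tij leNgt tj.
have s01 : 0 <= sin (al j) * w j 0 <= 1.
  have s0 : 0 <= sin (al j).
    by apply: sin_ge0_pi; rewrite aj0 (le_trans ajpi)//; move: pi_gt2; lra.
  by have := sin_le1 (al j); nra.
have m0 : meet m lam dl al w e 1 j.+2 0 =
  e 1 j.+2 0 / (pi / 2 * (lam - dl) * (sin (al j) * w j 0) + dl).
  by rewrite /meet /arrival big_ord1 rate_DR.
have /andP[s0 s1] := s01.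
have rD0 := rate_gt0 _ s0.
have mge y : pi / 2 * (lam - dl) * (sin (al j) * w j 0) + dl <= y ->
    y^-1 <= meet m lam dl al w e 1 j.+2 0.
  move=> hy; rewrite m0 -[leLHS]mul1r; apply: ler_pM => //.
    by rewrite invr_ge0 (le_trans (ltW rD0)).
  by rewrite lef_pV2 ?posrE// (lt_le_trans rD0).
have m0K : K^-1 <= meet m lam dl al w e 1 j.+2 0 by apply: mge; exact: rate_le.
have m0x : (x * (K + 1))^-1 <= meet m lam dl al w e 1 j.+2 0.
  (* In x (K + 1), the term x K bounds the angular part of the rate and x bounds dl. *)
  apply: mge; rewrite [leRHS]mulrDr mulr1 lerD//.
  have sx : sin (al j) * w j 0 <= x.
    case/andP: w01 => w0 w1; rewrite -[leRHS]mulr1.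
    apply: ler_pM => //; last exact: le_trans (sin_le_id _ _ aj0) alx.
    by apply: sin_ge0_pi; rewrite aj0 (le_trans ajpi)//; move: pi_gt2; lra.
  rewrite [leRHS]mulrC; apply: ler_pM => //; first exact: ltW.
  by apply: ler_wpM2l; [move: pi_gt2; lra|rewrite lerBlDr lerDl ltW].
rewrite le_min; apply/andP; split.
  rewrite tSDE -[leLHS]mul1r ler_pM ?invr_ge0//.
    by rewrite mulr_ge0 ?addr_ge0// ltW.
  rewrite lef_pV2 ?posrE ?mulr_gt0 ?addr_gt0//.
  by rewrite (le_trans dlx)// ler_peMr ?lerDr// ltW.
(* The set must be nonempty, since otherwise the infimum would be 0: the first D-R_j meeting, at
   time at least 1/K >= 1/(n K), follows the hand-over. *)
apply: lb_le_inf => [|_ [l /= _ <-]].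
  exists (meet m lam dl al w e 1 j.+2 0); exists 0%N => //=.
  apply: le_trans m0K; apply: (le_trans (ltW tj)).
  by rewrite lef_pV2 ?posrE// -[leLHS]mul1r ler_wpM2r// ltW.
(* Inter-arrival times are nonnegative, so no meeting precedes the one of index 0. *)
apply: (le_trans m0x); rewrite m0 /meet /arrival rate_DR//.
rewrite ler_wpM2r ?invr_ge0 ?(ltW rD0)// big_ord_recl lerDl.
by apply: sumr_ge0 => i _; exact: ejl.
Qed.
End Path.

(** From exp(-s) <= 1/(1 + s) and (1 + s)(1 - s/2) = 1 + s(1 - s)/2 >= 1. *)
Lemma one_sub_expRN_ge (R : realType) (s : R) : 0 < s <= 1 ->
  s / 2 <= 1 - expR (- s).
Proof.
move=> /andP[s0 s1].
have e1 : expR (- s) <= (1 + s)^-1.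
  by rewrite expRN lef_pV2 ?posrE ?expR_gt0 ?expR_ge1Dx// addr_gt0.
rewrite lerBrDl -lerBrDr (le_trans e1)// invf_ple ?posrE; last 2 first.
- by rewrite addr_gt0.
- by lra.
rewrite -[leLHS]mul1r ler_pdivrMr; last by lra.
by nra.
Qed.

Lemma prode_ge (R : realType) (I : eqType) (s : seq I) (l : I -> R) (F : I -> \bar R) :
  {in s, forall b, 0 <= l b} -> {in s, forall b, ((l b)%:E <= F b)%E} ->
  ((\prod_(b <- s) l b)%:E <= \prod_(b <- s) F b)%E.
Proof.
elim: s => [|b s IH] l0 lF; first by rewrite !big_nil.
rewrite !big_cons EFinM; apply: lee_pmul; rewrite ?lee_fin.
- by rewrite l0// mem_head.
- by rewrite big_seq prodr_ge0// => c cs; rewrite l0// in_cons cs orbT.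
- by rewrite lF// mem_head.
- by apply: IH => c cs; [rewrite l0|rewrite lF]; rewrite // in_cons cs orbT.
Qed.

(** * Probabilities of the events and the bound on the expectation *)

Section Events.
Context {R : realType} {d : measure_display} {Omega : measurableType d}.
Variables (P : probability Omega R) (m n : nat).
Variables (alpha : nat -> Omega -> R) (u : nat -> Omega -> nat -> R)
  (E : nat -> nat -> nat -> Omega -> R).
Hypotheses (m2 : (2 <= m)%N) (HM : FM_model P m n alpha u E).

(* On the resulting event every S-R_i meeting (i <> j) comes after the S-R_j one,
   and the first D-R_j meeting takes at least one unit of rescaled time.  The
   factor 4 absorbs the ratio between the largest possible rate and lambda_SRj
   (at most 8/3, as cos alpha_j >= 3/4). *)
Definition event_itv (j r : nat) (b : blk) : interval R :=
  match b with
  | inl (inl _) => `](2 ^+ r.+1)^-1, (2 ^+ r)^-1]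
  | inl (inr _) => `[0, 1]
  | inr (0, y, _) => if y == j.+2 then `[0, (4 * n)%:R^-1]
                     else if y == 1%N then `[1, +oo[ else `[n%:R^-1, +oo[
  | inr _ => `[1, +oo[
  end.

Definition event_box (j r : nat) (b : blk) (_ : nat) : set R :=
  [set` event_itv j r b].

(** Free of repetitions, as the product rule for independence requires: the S-R_j block occurs only
    in the [iota] part. *)
Definition event_blks (j : nat) : seq blk :=
  [:: inl (inl j); inl (inr j); inr (0, 1, 0); inr (1, j.+2, 0)]%N ++
  [seq inr (0, i.+2, 0)%N | i <- iota 0 n].

Definition blk_event (B : blk -> nat -> set R) (b : blk) : set Omega :=
  [set om | forall j, (j < blk_dim m b)%N -> B b j (blk_rv alpha u E b om j)].

Definition event (j r : nat) : set Omega :=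
  \big[setI/setT]_(b <- event_blks j) blk_event (event_box j r) b.

Lemma measurable_event_box j r b i : measurable (event_box j r b i).
Proof. exact: measurable_itv. Qed.

Lemma measurable_blk_event B b : (forall b j, measurable (B b j)) ->
  measurable (blk_event B b).
Proof.
case: HM => -[mal mu mE _] _ mB.
rewrite (_ : blk_event B b = \bigcap_(j in `I_(blk_dim m b))
  ((fun om => blk_rv alpha u E b om j) @^-1` B b j)); last first.
  by apply/seteqP; split.
apply: bigcap_measurableType => j _; rewrite -[_ @^-1` _]setTI.
by case: b => [[i|i]|[[x y] l]]; [exact: mal|exact: mu|exact: mE].
Qed.

Lemma measurable_event j r : measurable (event j r).
Proof.
apply: bigsetI_measurable => b _.
by apply: measurable_blk_event => *; exact: measurable_event_box.
Qed.

Lemma eventP j r om : event j r om ->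
  [/\ (2 ^+ r.+1)^-1 < alpha j om <= (2 ^+ r)^-1,
      0 <= u j om 0 <= 1,
      1 <= E 0 1 0 om /\ 1 <= E 1 j.+2 0 om,
      (j < n)%N -> 0 <= E 0 j.+2 0 om <= (4 * n)%:R^-1 &
      forall i, (i < n)%N -> i != j -> n%:R^-1 <= E 0 i.+2 0 om].
Proof.
rewrite /event -bigcap_seq => ev.
have get b : b \in event_blks j -> forall i, (i < blk_dim m b)%N ->
    blk_rv alpha u E b om i \in event_itv j r b by move=> /ev h i /h.
have tl i : (i < n)%N -> inr (0, i.+2, 0)%N \in event_blks j.
  by move=> lin; rewrite mem_cat map_f ?orbT// mem_iota.
split.
- by have := get (inl (inl j)) (mem_head _ _) 0%N erefl; rewrite /= in_itv.
- have /get/(_ 0%N) : inl (inr j) \in event_blks j by rewrite !inE eqxx orbT.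
  by rewrite /= in_itv/= -subn1 subn_gt0; apply.
- have /get/(_ 0%N erefl) : inr (0, 1, 0)%N \in event_blks j.
    by rewrite !inE eqxx !orbT.
  have /get/(_ 0%N erefl) : inr (1, j.+2, 0)%N \in event_blks j.
    by rewrite !inE eqxx !orbT.
  by rewrite /= !in_itv/= !andbT.
- by move=> /tl/get/(_ 0%N erefl); rewrite /= eqxx in_itv.
- move=> i /tl/get/(_ 0%N erefl); rewrite /= => + /negbTE ij.
  by rewrite !eqSS ij in_itv/= andbT.
Qed.

(** Lets the contributions of all relays and scales be added up. For distinct relays, the variable
    of S-R_j would be both at most 1/(4n) and at least 1/n; for distinct scales, the half-open
    dyadic intervals are disjoint. *)
Lemma event_disjoint j j' r r' om : (j < n)%N -> (j' < n)%N ->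
  event j r om -> event j' r' om -> j = j' /\ r = r'.
Proof.
move=> jn j'n ev ev'.
have jj : j = j'.
  apply/eqP/negPn/negP => jj'.
  have [_ _ _ /(_ jn)/andP[_ h] _] := eventP _ _ _ ev.
  have [_ _ _ _ /(_ j jn jj')] := eventP _ _ _ ev'.
  rewrite leNgt (le_lt_trans h)// ltf_pV2 ?posrE ?ltr0n ?muln_gt0 ?(leq_ltn_trans _ jn)//.
  by rewrite ltr_nat ltn_Pmull// (leq_ltn_trans _ jn).
subst j'; split => //.
have lt a b : event j a om -> event j b om -> (a < b)%N -> False.
  move=> ea eb ab.
  have [/andP[h _] _ _ _ _] := eventP _ _ _ ea.
  have [/andP[_ h'] _ _ _ _] := eventP _ _ _ eb.
  have := lt_le_trans h h'; rewrite ltNge lef_pV2 ?posrE ?exprn_gt0//.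
  by rewrite ler_eXn2l ?ltr1n// ab.
by case: (ltngtP r r') => // [/(lt _ _ ev ev')|/(lt _ _ ev' ev)].
Qed.

(* Volume of the box [1/2k, 1/k]^k, k = m - 1, whose points have norm at most 1
   and direction in [0, 1]^k. *)
Definition box_mass : R := ((2 * m.-1)%:R^-1) ^+ m.-1.

Lemma box_mass_gt0 : 0 < box_mass.
Proof. by rewrite exprn_gt0// invr_gt0 ltr0n muln_gt0/= -subn1 subn_gt0. Qed.

(** The law of the direction is a cone volume divided by the volume of the ball part, which is at
    most 1 because it is computed inside the unit cube. *)
Lemma direction_box_ge i : (i < n)%N ->
  (box_mass%:E <= P [set om | forall j, (j < m.-1)%N -> `[0%R, 1%R]%classic (u i om j)])%E.
Proof.
case: HM => _ [_ Pu _] lin.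
have m1 : (0 < m.-1)%N by rewrite -subn1 subn_gt0.
apply: (le_trans (orth_cone_unit_box _ m1)).
rewrite -(Pu _ lin)// -[leRHS]mule1 lee_wpmul2l//.
by apply: cube_int_le1 => v; rewrite lee_fin indicE// lern1 leq_b1.
Qed.

(** Lower bounds for the probabilities of the single blocks. The factor exp(-1/n) is kept for relay
    j too, so that the product over the n relays contains exactly exp(-1); 1/(8n) is half of 1/(4n),
    by [one_sub_expRN_ge]. *)
Definition blk_mass (j r : nat) (b : blk) : R :=
  match b with
  | inl (inl _) => (2 ^+ r)^-1 / pi
  | inl (inr _) => box_mass
  | inr (0, y, _) => if y == 1%N then expR (- 1) else
       expR (- n%:R^-1) * (if y == j.+2 then (8 * n)%:R^-1 else 1)
  | inr _ => expR (- 1)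
  end.

Lemma blk_mass_ge0 j r b : 0 <= blk_mass j r b.
Proof.
case: b => [[_|_]|[[[|x] y] l]] /=.
- by rewrite divr_ge0 ?pi_ge0// invr_ge0 exprn_ge0.
- exact/ltW/box_mass_gt0.
- by case: ifP => _; rewrite ?expR_ge0// mulr_ge0 ?expR_ge0//; case: ifP.
- exact: expR_ge0.
Qed.

Lemma blk_event_ge j r b : (0 < r)%N -> (j < n)%N -> b \in event_blks j ->
  ((blk_mass j r b)%:E <= P (blk_event (event_box j r) b))%E.
Proof.
move=> r0 jn; case: HM => -[mal mu mE _] [Pal Pu PE].
have n0 : (0 < n)%N by exact: leq_ltn_trans jn.
have scal b0 (X : Omega -> R) : blk_dim m b0 = 1%N ->
    (forall om i, blk_rv alpha u E b0 om i = X om) ->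
    blk_event (event_box j r) b0 = X @^-1` [set` event_itv j r b0].
  move=> dim1 rv; rewrite /blk_event dim1; apply/seteqP; split => om /=.
    by move=> /(_ 0%N erefl); rewrite rv.
  by move=> h i _; rewrite /event_box rv.
rewrite mem_cat !inE => /orP[/or4P[]/eqP->|/mapP[i + ->]].
- rewrite (scal _ (alpha j))//=.
  have pi2 : (0 : R) < pi / 2 by rewrite divr_gt0// pi_gt0.
  have e2 : (2 ^+ r)^-1 = 2 * (2 ^+ r.+1)^-1 :> R.
    by rewrite exprS invfM mulrA divff// mul1r.
  have p0 : (0 : R) < (2 ^+ r.+1)^-1 by rewrite invr_gt0 exprn_gt0.
  rewrite (uniform_itv P _ _ _ (Pal j jn)).
  + rewrite lee_fin subr0 e2.
    move: (pi_gt0 R); move: (@pi R) => q q0.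
    rewrite le_eqVlt; apply/orP; left; apply/eqP.
    by field; rewrite (gt_eqF q0) expf_neq0.
  + exact: ltW.
  + by rewrite e2; lra.
  + have r1 : (2 ^+ r)^-1 <= 1 :> R by rewrite invf_le1 ?exprn_gt0// exprn_ege1// ler1n.
    by have := pi_ge2 R; lra.
- exact: direction_box_ge.
- rewrite (scal _ (E 0 1 0))//=.
  exact: (exponential_tail P _ (mE _ _ _) (PE _ _ _ _ _)).
- rewrite (scal _ (E 1 j.+2 0))//=.
  exact: (exponential_tail P _ (mE _ _ _) (PE _ _ _ _ _)).
- rewrite mem_iota/= => lin; rewrite (scal _ (E 0 i.+2 0))//= !eqSS.
  have PX : forall B, measurable B -> P (E 0 i.+2 0 @^-1` B) = exponential_prob 1 B.
    by apply: PE => //; rewrite !ltnS.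
  case: ifP => _.
    rewrite exponential_head//; last by rewrite invr_gt0 ltr0n muln_gt0.
    have n41 : 0 < ((4 * n)%:R^-1 : R) <= 1.
      have n4 : (0 < 4 * n)%N by rewrite muln_gt0.
      by rewrite invr_gt0 ltr0n n4/= invf_le1 ?ler1n ?ltr0n.
    have := one_sub_expRN_ge _ _ n41; rewrite lee_fin; apply: le_trans.
    rewrite (_ : (4 * n)%:R^-1 / 2 = (8 * n)%:R^-1); last first.
      by rewrite !natrM; field; rewrite pnatr_eq0 -lt0n.
    by rewrite ler_piMl// -expR0 ler_expR oppr_le0.
  rewrite mulr1; apply: exponential_tail => //.
  by rewrite invr_gt0 ltr0n.
Qed.

(** By independence the block bounds multiply. One factor 1/e comes from S-D, one from D-R_j, and
    one from all the S-R_i together. *)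
Lemma event_ge j r : (0 < r)%N -> (j < n)%N ->
  (((2 ^+ r)^-1 / n%:R * (box_mass * expR (- 3) / (8 * pi)))%:E <= P (event j r))%E.
Proof.
move=> r0 jn; case: (HM) => -[_ _ _ ind] _.
have n0 : (n%:R : R) != 0 by rewrite pnatr_eq0 -lt0n (leq_ltn_trans _ jn).
rewrite /event /blk_event ind; last 3 first.
- rewrite cat_uniq map_inj_uniq ?iota_uniq; last by move=> a b [].
  rewrite /= andbT; by apply/hasPn => b /mapP[i _ ->].
- rewrite /= jn !ltnS jn/= all_map; apply/allP => i.
  by rewrite mem_iota/= !ltnS.
- exact: measurable_event_box.
apply: (@le_trans _ _ (\prod_(b <- event_blks j) blk_mass j r b)%:E); last first.
  apply: prode_ge => b bs; first exact: blk_mass_ge0.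
  exact: blk_event_ge.
rewrite lee_fin big_cat !big_cons big_nil big_map/= big_split/=.
have -> : \prod_(i <- iota 0 n) expR (- n%:R^-1) = expR (- 1 : R).
  rewrite big_const_seq count_predT size_iota iter_mulr_1 -expRM_natl.
  by rewrite mulrN mulfV.
have -> : \prod_(i <- iota 0 n) (if i.+2 == j.+2 then (8 * n)%:R^-1 else 1)
   = (8 * n)%:R^-1 :> R.
  rewrite (_ : iota 0 n = index_iota 0 n); last by rewrite /index_iota subn0.
  rewrite big_mkord (bigD1 (Ordinal jn))//= eqxx big1 ?mulr1// => i.
  by rewrite -val_eqE/= !eqSS => /negbTE ->.
rewrite (_ : - 3 = -1 + -1 + -1 :> R); last by ring.
rewrite !expRD natrM le_eqVlt; apply/orP; left; apply/eqP.
move: (pi_gt0 R); move: (@pi R) => q q0; field.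
by rewrite n0 (gt_eqF q0) expf_neq0.
Qed.

(** The laws confine angles and inter-arrival times to their supports only almost surely; the
    countably many exceptional sets are gathered into one null set. *)
Lemma model_ae : {ae P, forall om, (forall i, (i < n)%N -> 0 <= alpha i om <= pi / 2) /\
  (forall x y l, (x < y)%N -> (y < n.+2)%N -> 0 <= E x y l om)}.
Proof.
case: HM => -[mal mu mE _] [Pal _ PE].
have neg (X : Omega -> R) (B : set R) (Q : Prop) : measurable_fun setT X -> measurable B ->
    (Q -> P (X @^-1` B) = 0%E) -> {ae P, forall om, Q -> ~ B (X om)}.
  move=> mX mB PB; have [q|q] := pselect Q; last first.
    by apply: filterE => om /q.
  exists (X @^-1` B); split; [|exact: PB|].
    by rewrite -[_ @^-1` _]setTI; exact: mX.
  by move=> om /= /not_implyP[_ /contrapT].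
apply: filterI.
  apply: ae_foralln => i.
  apply: filterS (neg (alpha i) (~` `[0, pi / 2]) (i < n)%N _ _ _) => //.
  - by move=> om /= h /h /contrapT; rewrite in_itv.
  - exact: measurableC.
  - by move=> lin; exact: uniform_outside0 (Pal i lin).
apply: ae_foralln => x; apply: ae_foralln => y; apply: ae_foralln => l.
apply: filterS (neg (E x y l) `]-oo, 0[%classic
  ((x < y)%N /\ (y < n.+2)%N) _ _ _) => //.
- move=> om /= h xy yn; rewrite leNgt; apply/negP => E0.
  by apply: h => //; rewrite in_itv.
- by move=> [xy yn]; apply: exponential_neg0 => //; exact: PE.
Qed.

Lemma event_T_FM_ge (lam dl : R) j r om : 0 < lam -> 0 < dl -> dl <= lam / 2 ->
  (0 < r)%N -> dl <= (2 ^+ r)^-1 -> (j < n)%N ->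
  (forall i, (i < n)%N -> 0 <= alpha i om <= pi / 2) ->
  (forall x y l, (x < y)%N -> (y < n.+2)%N -> 0 <= E x y l om) ->
  event j r om -> 2 ^+ r / (pi / 2 * lam + 1) <= T_FM_rv m n lam dl alpha u E om.
Proof.
move=> lam0 dl0 dlle r0 dlr jn al E0 ev.
have [/andP[_ ar] u01 [eD ej] etj ei] := eventP _ _ _ ev.
have -> : 2 ^+ r / (pi / 2 * lam + 1) = ((2 ^+ r)^-1 * (pi / 2 * lam + 1))^-1.
  by rewrite invfM invrK.
apply: (T_FM_ge _ _ _ _ _ _ _ m2 lam0 dl0 dlle al (Ordinal jn)) => //=.
- rewrite invr_gt0 exprn_gt0//= lef_pV2 ?posrE ?exprn_gt0//.
  by rewrite -[leLHS]expr1 ler_eXn2l// ltr1n.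
- exact: etj.
- by move=> l; rewrite E0// !ltnS.
Qed.

Lemma expectation_ge (lam dl : R) (L : nat) : 0 < lam -> 0 < dl -> dl <= lam / 2 ->
  dl <= (2 ^+ L)^-1 -> (0 < n)%N ->
  ((L%:R * (box_mass * expR (- 3) / (8 * pi) / (pi / 2 * lam + 1)))%:E <=
   \int[P]_om (T_FM_rv m n lam dl alpha u E om)%:E)%E.
Proof.
move=> lam0 dl0 dlle dlL n0.
have [N [mN N0 goodN]] := model_ae.
have good om : ~ N om -> (forall i, (i < n)%N -> 0 <= alpha i om <= pi / 2) /\
    (forall x y l, (x < y)%N -> (y < n.+2)%N -> 0 <= E x y l om).
  by move=> nN; apply: contrapT => h; apply: nN; exact: goodN.
set K := pi / 2 * lam + 1.
have K0 : 0 < K by rewrite addr_gt0// !mulr_gt0// ?invr_gt0// pi_gt0.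
set C := box_mass * expR (- 3) / (8 * pi).
(* Scales run from 1 to L: the shift ensures 2^-r <= 1/2, as the bound on the path requires. *)
pose A (p : 'I_n * 'I_L) := event p.1 p.2.+1 `\` N.
have mA p : measurable (A p) by apply: measurableD => //; exact: measurable_event.
pose c (p : 'I_n * 'I_L) : R := 2 ^+ p.2.+1 / K.
have c0 p : 0 <= c p by rewrite divr_ge0 ?exprn_ge0// ltW.
(* A measurable step function below [T_FM], whose integral can be computed term by term. *)
pose g om : \bar R := (\sum_p (c p)%:E * (\1_(A p) om)%:E)%E.
have PA (p : 'I_n * 'I_L) : (((2 ^+ p.2.+1)^-1 / n%:R * C)%:E <= P (A p))%E.
  apply: (le_trans (event_ge _ _ _ (ltn_ord p.1))) => //.
  rewrite -[leRHS]adde0 -N0; apply: (@le_trans _ _ (P (A p `|` N))); last first.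
    exact: measureU2.
  apply: le_measure; rewrite ?inE; first exact: measurable_event.
    exact: measurableU.
  by move=> om ev; have [?|?] := pselect (N om); [right|left].
have mind p : measurable_fun setT (fun om => (\1_(A p) om)%:E : \bar R).
  by apply/measurable_EFinP; exact: measurable_indic.
have ind0 p om : (0 <= (\1_(A p) om)%:E :> \bar R)%E by rewrite lee_fin.
have cE0 p : (0 <= (c p)%:E)%E by rewrite lee_fin.
have gE : (\int[P]_om g om = \sum_p (c p)%:E * P (A p))%E.
  rewrite ge0_integral_sum//; last 2 first.
  - by move=> p; exact: measurable_funeM.
  - by move=> p om _; exact: mule_ge0.
  apply: eq_bigr => p _.
  rewrite (ge0_integralZl P measurableT (mind p))//.
  by rewrite integral_indic// setIT.
apply: (@le_trans _ _ (\int[P]_om g om)%E).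
  (* The powers of 2 in the value and in the probability cancel, so each of the n L pairs
     contributes at least C/(n K). *)
  rewrite gE; apply: (@le_trans _ _ (\sum_(p : 'I_n * 'I_L) (n%:R^-1 * (C / K))%:E)%E).
    rewrite sumEFin lee_fin sumr_const card_prod !card_ord -[leRHS]mulr_natl natrM.
    rewrite le_eqVlt; apply/orP; left; apply/eqP.
    by field; rewrite (gt_eqF K0) pnatr_eq0 -lt0n.
  apply: lee_sum => p _; apply: le_trans (lee_wpmul2l _ (PA p)); last first.
    by rewrite lee_fin.
  rewrite -EFinM lee_fin /c le_eqVlt; apply/orP; left; apply/eqP.
  by field; rewrite (gt_eqF K0) pnatr_eq0 -lt0n n0 expf_neq0.
apply: (ae_ge0_le_integral_nonmeasurable P N _ _ mN N0).
- move=> om /good[al E0]; rewrite lee_fin.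
  apply: T_FM_ge0 => // y /andP[y0 yn]; exact: E0.
- by move=> om; apply: sume_ge0 => p _; rewrite mule_ge0 ?lee_fin.
(* By disjointness at most one term of [g] is nonzero at each outcome. *)
- move=> om; have [[p Ap]|nA] := pselect (exists p, A p om).
    rewrite /g (bigD1 p)//= big1 ?adde0 => [|q qp]; last first.
      rewrite indicE memNset ?mule0// => Aq; move/eqP: qp; apply.
      have [] := event_disjoint _ _ _ _ _ (ltn_ord q.1) (ltn_ord p.1) Aq.1 Ap.1.
      by case: q p {Aq Ap} => [q1 q2] [p1 p2] /= /val_inj -> [/val_inj ->].
    rewrite indicE mem_set// mule1 funeposE le_max; apply/orP; left.
    rewrite lee_fin; case: Ap => ev /good[al E0].
    apply: (event_T_FM_ge _ _ p.1) => //.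
    rewrite (le_trans dlL)// lef_pV2 ?posrE ?exprn_gt0//.
    by rewrite ler_eXn2l ?ltr1n.
  rewrite /g big1 => [|p _]; first by rewrite funeposE le_max lexx orbT.
  by rewrite indicE memNset ?mule0// => Ap; apply: nA; exists p.
Qed.
End Events.

(** * Choice of the number of scales and conclusion *)

Lemma T_FM_expectation_ge_ln (R : realType) (m : nat) (lam : R)
    (delta : nat -> R) :
  (2 <= m)%N -> 0 < lam -> (forall n, 0 < delta n) -> delta @ \oo --> 0 ->
  exists2 c : R, 0 < c & \forall n \near \oo,
    forall (d : measure_display) (Omega : measurableType d)
           (P : probability Omega R) alpha u E,
      FM_model P m n alpha u E ->
      ((c * ln (delta n)^-1)%:E
       <= \int[P]_om (T_FM_rv m n lam (delta n) alpha u E om)%:E)%E.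
Proof.
move=> m2 lam0 delta0 delta_cvg.
set C : R := box_mass m * expR (- 3) / (8 * pi) / (pi / 2 * lam + 1).
have C0 : 0 < C.
  by rewrite !divr_gt0 ?mulr_gt0 ?box_mass_gt0 ?expR_gt0 ?pi_gt0 ?addr_gt0//
    ?mulr_gt0 ?divr_gt0 ?pi_gt0.
(* The factor 1/2 absorbs the rounding of log(1/delta) down to an integer number of scales. *)
exists (C / 2); first by rewrite divr_gt0.
near=> n => d Omega P alpha u E HM.
have d0 := delta0 n.
set x := ln (delta n)^-1.
have expx : expR x = (delta n)^-1 by rewrite lnK// posrE invr_gt0.
have x2 : 2 <= x.
  rewrite -ler_expR expx -[leLHS]invrK -expRN lef_pV2 ?posrE ?expR_gt0//.
  by near: n; apply: (cvgr_le _ delta_cvg); exact: expR_gt0.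
have x0 : 0 <= x by exact: le_trans x2.
have /andP[Lx xL] := truncn_itv x0.
set L := truncn x in Lx xL.
apply: (@le_trans _ _ (L%:R * C)%:E).
  rewrite lee_fin (_ : C / 2 * x = x / 2 * C); last by ring.
  apply: ler_wpM2r; first exact: ltW.
  (* From x < L + 1 and x >= 2, L > x - 1 >= x/2. *)
  by move: xL; rewrite -natr1; lra.
apply: (expectation_ge P m n alpha u E m2 HM) => //.
- by near: n; apply: (cvgr_le _ delta_cvg); rewrite divr_gt0.
- rewrite -[leLHS]invrK -expx lef_pV2 ?posrE ?expR_gt0 ?exprn_gt0//.
  (* As 2 <= e, 2^L <= e^L <= e^x = 1/delta. *)
  apply: (@le_trans _ _ (expR 1 ^+ L)).
    by rewrite lerXn2r ?nnegrE ?expR_ge0//; have := expR_ge1Dx (1 : R).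
  by rewrite -expRM_natl mulr1 ler_expR.
- by near: n; exact: nbhs_infty_gt.
Unshelve. all: by end_near. Qed.

Theorem theorem1 (R : realType) (m : nat) (lam : R) (delta : nat -> R) :
  (2 <= m)%N -> 0 < lam -> (forall n, 0 < delta n) -> delta @ \oo --> 0 ->
  (exists c c' : R, 0 < c /\ 0 < c' /\
    \forall n \near \oo,
      forall (d : measure_display) (Omega : measurableType d)
             (P : probability Omega R) alpha u E,
        FM_model P m n alpha u E ->
        ((minr (c * ln (delta n)^-1) (c' * n%:R / ln n%:R))%:E
         <= \int[P]_om (T_FM_rv m n lam (delta n) alpha u E om)%:E)%E)
  /\
  (forall M : R,
    \forall n \near \oo,
      forall (d : measure_display) (Omega : measurableType d)
             (P : probability Omega R) alpha u E,
        FM_model P m n alpha u E ->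
        (M%:E <= \int[P]_om (T_FM_rv m n lam (delta n) alpha u E om)%:E)%E).
Proof.
move=> m2 lam0 delta0 delta_cvg.
have [c c0 Hc] := T_FM_expectation_ge_ln _ _ _ _ m2 lam0 delta0 delta_cvg.
split.
  (* The logarithmic term alone is a lower bound, so any positive c' would do. *)
  exists c, 1; split => //; split => //.
  apply: filterS Hc => n h d Omega P alpha u E /h; apply: le_trans.
  by rewrite lee_fin ge_min lexx.
move=> M; near=> n => d Omega P alpha u E HM.
have hn : forall (d : measure_display) (Omega : measurableType d)
    (P : probability Omega R) alpha u E, FM_model P m n alpha u E ->
    ((c * ln (delta n)^-1)%:E <=
     \int[P]_om (T_FM_rv m n lam (delta n) alpha u E om)%:E)%E by near: n.
apply: le_trans (hn _ _ _ _ _ _ HM).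
(* The inequality amounts to delta(n) <= exp(-M/c), which holds eventually. *)
rewrite lee_fin mulrC -ler_pdivrMr// -ler_expR lnK ?posrE ?invr_gt0//.
rewrite -[leLHS]invrK -expRN lef_pV2 ?posrE ?expR_gt0//.
by near: n; apply: (cvgr_le _ delta_cvg); exact: expR_gt0.
Unshelve. all: by end_near. Qed.
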